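(* Let $k\ge 2$ be a constant integer. The communication complexity of constructing a $+k$-spanner of an unweighted undirected distributed graph on $n$ vertices with edges observed at $s$ sites in the blackboard model without duplication is $\Omega(s+n^{4/3-o(1)})$.
   Context: Distributed graph: there are $s$ sites $S_1,\dots,S_s$; all know the common vertex set $V$, $|V|=n$, and site $S_i$ holds a subset $E_i\subseteq E$ of the edges of an undirected graph $G=(V,E)$, where $E=\bigcup_{i=1}^s E_i$. In the setting without duplication the sets $E_i$ are pairwise disjoint. Blackboard model: sites communicate by writing messages on a shared blackboard (a broadcast channel) visible to all sites and to a coordinator, who must output the result. The communication cost of a protocol is the total number of bits communicated (in the worst case); the communication complexity of a problem is the least communication cost of a (randomized, bounded constant error) protocol solving it. Spanner: a $+k$-spanner of $G$ is a subgraph $H=(V,E')$, $E'\subseteq E$, with $d_H(u,v)\le d_G(u,v)+k$ for all $u,v\in V$, where $d$ denotes shortest-path distance. The $o(1)$ in the exponent tends to $0$ as $n\to\infty$. *)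

(* Defs.v *)
From HB Require Import structures.
From mathcomp Require Import all_boot all_order all_algebra.
From mathcomp Require Import all_classical all_reals all_analysis.

Set Implicit Arguments.
Unset Strict Implicit.
Unset Printing Implicit Defensive.

Import Order.TTheory GRing.Theory Num.Theory.

Local Open Scope classical_set_scope.
Local Open Scope ring_scope.

Definition edge_set (n : nat) := {set {set 'I_n}}.

Definition simple (n : nat) (E : edge_set n) : bool :=
  [forall e in E, #|e| == 2%N].

Definition adj (n : nat) (E : edge_set n) : rel 'I_n :=
  fun u v => [set u; v]%SET \in E.

(* Equal to [+oo] when [u] and [v] lie in different components, since then the
   infimum is over the empty set. *)
Definition dist (R : realType) (n : nat) (E : edge_set n) (u v : 'I_n) : \bar R :=
  ereal_inf [set ((size p)%:R)%:E | p in
    [set p : seq 'I_n | path (adj E) u p && (last u p == v)]].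

Definition additive_spanner (R : realType) (n k : nat) (G H : edge_set n) : bool :=
  (H \subset G) &&
  [forall u, forall v, (dist R H u v <= dist R G u v + (k%:R)%:E)%E].

(* A deterministic protocol is a protocol tree whose position encodes the
   content of the blackboard. That content alone determines who writes next;
   the bit written by site [i] is a function of the board and of the input of
   [i]. The coordinator holds no input, so the value it outputs is a function of
   the final board, i.e. a label of the leaf. *)
Inductive protocol (s : nat) (X Y : Type) : Type :=
| Output of Y
| Write of 'I_s & (X -> bool) & (bool -> protocol s X Y).

Fixpoint output (s : nat) (X Y : Type) (P : protocol s X Y) (x : 'I_s -> X) : Y :=
  match P with
  | Output y => y
  | Write i b next => output (next (b (x i))) x
  end.

Fixpoint bits (s : nat) (X Y : Type) (P : protocol s X Y) (x : 'I_s -> X) : nat :=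
  match P with
  | Output _ => 0
  | Write i b next => (bits (next (b (x i))) x).+1
  end.

(* Public coins, which can simulate private coins of the sites and of the
   coordinator. Only finitely many deterministic behaviours exist for finite
   inputs and bounded cost, so finite probability spaces (with arbitrary real
   weights) are fully general. *)
Record rand_protocol (R : realType) (s : nat) (X Y : Type) := RandProtocol {
  seed : finType;
  weight : seed -> R;
  weight_ge0 : forall w, 0 <= weight w;
  weight_sum1 : \sum_w weight w = 1;
  det_protocol : seed -> protocol s X Y
}.

Definition comm_cost (R : realType) (s : nat) (X : finType) (Y : Type)
    (valid : pred {ffun 'I_s -> X}) (P : rand_protocol R s X Y) : nat :=
  \max_(w : seed P) \max_(x | valid x) bits (det_protocol w) x.

Definition solves (R : realType) (s : nat) (X : finType) (Y : Type)
    (valid : pred {ffun 'I_s -> X}) (correct : {ffun 'I_s -> X} -> Y -> bool)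
    (eps : R) (P : rand_protocol R s X Y) : Prop :=
  forall x, valid x ->
    1 - eps <= \sum_(w : seed P | correct x (output (det_protocol w) x)) weight w.

Definition comm_complexity (R : realType) (s : nat) (X : finType) (Y : Type)
    (valid : pred {ffun 'I_s -> X}) (correct : {ffun 'I_s -> X} -> Y -> bool)
    (eps : R) : \bar R :=
  ereal_inf [set c | exists2 P : rand_protocol R s X Y,
    solves valid correct eps P & c = ((comm_cost valid P)%:R)%:E].

Definition no_duplication (n s : nat) (x : {ffun 'I_s -> edge_set n}) : bool :=
  [forall i, simple (x i)] &&
  [forall i, forall j, (i != j) ==> [disjoint x i & x j]].

Definition union_graph (n s : nat) (x : {ffun 'I_s -> edge_set n}) : edge_set n :=
  (\bigcup_(i < s) x i)%SET.

Definition spanner_complexity (R : realType) (k : nat) (eps : R) (n s : nat) : \bar R :=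
  comm_complexity (@no_duplication n s)
    (fun x H => additive_spanner R k (union_graph x) H) eps.

(* Main.v *)
(** The bound [Omega(s)] compares the empty input with the inputs in which a
single edge is given to site [i]: their correct outputs are disjoint, so on the
empty input site [i] must write with probability at least [1 - 2 * eps], and
summing over [i] bounds the expected number of bits.

For the other term the whole graph is given to one site, and we exhibit
[2 ^ |P|] graphs such that no [H] is a spanner of two of them; then a
deterministic protocol of cost [C] is correct on at most [2 ^ C] of them. The
graphs come from the obstacle product of Abboud and Bodwin. The outer graph has
layers [Z * Z], whose two coordinates are advanced alternately by [phi u], with
[phi u] on a paraboloid; by strict convexity the monotone path from [z] which
alternates between the directions [u] and [v] is the only one joining its ends,
and two such paths share at most one edge. Every outer edge is subdivided into
[k] edges, and every outer vertex is replaced by a complete bipartite graph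
between the ends of the chains that enter it and the starts of the chains that
leave it. Each demand [(z, u, v)] then owns the bipartite edges on its path;
deleting them forces a detour at every outer vertex of the path, or else a
backward walk along a whole chain, and lengthens the path by more than [k]. With
[u] in [[0, b)^D] there are about [b ^ (3D)] vertices and [b ^ (4D)] demands, up
to a bounded power of [b], and [D] may be taken arbitrarily large. *)

Require Import Defs.
From HB Require Import structures.
From mathcomp Require Import all_boot all_order all_algebra.
From mathcomp Require Import all_classical all_reals all_analysis.
From mathcomp Require Import zify ring lra.

Set Implicit Arguments.
Unset Strict Implicit.
Unset Printing Implicit Defensive.

Import Order.TTheory GRing.Theory Num.Theory.
Import numFieldNormedType.Exports.

Local Open Scope classical_set_scope.
Local Open Scope ring_scope.

(** * The obstacle product *)

Section ObstacleProduct.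

Variables (k : nat) (Z : finZmodType) (U : finType) (phi : U -> Z).
Hypothesis k_gt0 : (0 < k)%N.
Hypothesis phi_convex : forall (u : U) (w : nat -> U),
  \sum_(j < k) phi (w j) = phi u *+ k -> forall j, (j < k)%N -> w j = u.

(** A demand makes [2 * k] outer steps, [k] in each coordinate, and its route stops on the last
    vertex of the last chain. *)
Definition top_height : nat := (2 * k * k.+1).-1.

(* The chain of [k.+1] vertices that subdivides the outer edge leaving [z] in
   direction [u] at layer [i] occupies the heights from [i * k.+1] to
   [i * k.+1 + k]. *)
Definition vertex := ('I_top_height.+1 * (Z * Z) * U)%type.

Definition height (a : vertex) : nat := a.1.1.
Definition layer (a : vertex) : nat := height a %/ k.+1.

Definition step (i : nat) (z : Z * Z) (u : U) : Z * Z :=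
  if odd i then (z.1, z.2 + phi u) else (z.1 + phi u, z.2).

Fixpoint pos (z : Z * Z) (w : nat -> U) (i : nat) : Z * Z :=
  if i is j.+1 then step j (pos z w j) (w j) else z.

(** When [k.+1] divides the height of [b], the direction [b.2] is left free: such arcs join every
    chain end arriving at an outer vertex to every chain start leaving it. *)
Definition arc (a b : vertex) : bool :=
  (height b == (height a).+1) &&
  (if (k.+1 %| height b)%N then b.1.2 == step (layer a) a.1.2 a.2
   else (b.1.2 == a.1.2) && (b.2 == a.2)).

Definition demand := ((Z * Z) * (U * U))%type.

Definition dir (p : demand) (i : nat) : U := if odd i then p.2.2 else p.2.1.

Definition route (p : demand) (t : nat) : vertex :=
  (inord t, pos p.1 (dir p) (t %/ k.+1), dir p (t %/ k.+1)).

Definition critical (p : demand) (a b : vertex) : bool :=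
  [&& (k.+1 %| height b)%N, a == route p (height a) & b == route p (height b)].

Definition kept_arc (x : {set demand}) : rel vertex :=
  fun a b => arc a b && [forall p, critical p a b ==> (p \in x)].

Definition kept_edge (x : {set demand}) : rel vertex :=
  fun a b => kept_arc x a b || kept_arc x b a.

(** * Outer positions and strict convexity *)

Lemma step_inj i u : injective (step i ^~ u).
Proof.
move=> [a b] [c d]; rewrite /step /=.
by case: (odd i) => -[/= e1 e2]; [rewrite e1 (addIr _ e2)|rewrite (addIr _ e1) e2].
Qed.

Lemma eq_pos z w w' i : (forall j, (j < i)%N -> w j = w' j) -> pos z w i = pos z w' i.
Proof.
elim: i => //= i IH ww'; rewrite IH ?ww' // => j ji.
by apply: ww'; apply: ltnW.
Qed.

Lemma pos_inj w i : injective (fun z => pos z w i).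
Proof. by elim: i => [|i IH] a b //= /step_inj /IH. Qed.

Lemma pos_double z w i :
  pos z w i.*2 = (z.1 + \sum_(j < i) phi (w j.*2), z.2 + \sum_(j < i) phi (w j.*2.+1)).
Proof.
elim: i => [|i IH]; first by rewrite !big_ord0 !addr0; case: z.
by rewrite doubleS /= IH /step /= odd_double /= !big_ord_recr /= !addrA.
Qed.

(** After [k.*2] alternating steps each coordinate has received [k] values of [phi], and along the
    route of [p] these all come from one direction; so [phi_convex] applies to each coordinate
    separately. *)
Lemma pos_convex (p : demand) w : pos p.1 w k.*2 = pos p.1 (dir p) k.*2 ->
  forall j, (j < k.*2)%N -> w j = dir p j.
Proof.
rewrite !pos_double => -[/addrI e1 /addrI e2] j jk.
rewrite -[j]odd_double_half /dir oddD odd_double addbF oddb.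
have jk2 : (j./2 < k)%N by lia.
case: (odd j).
- apply: (@phi_convex p.2.2 (fun i => w i.*2.+1)) => //.
  rewrite e2 (eq_bigr (fun=> phi p.2.2)) ?sumr_const ?card_ord // => i _.
  by rewrite /dir /= odd_double.
- rewrite add0n; apply: (@phi_convex p.2.1 (fun i => w i.*2)) => //.
  rewrite e1 (eq_bigr (fun=> phi p.2.1)) ?sumr_const ?card_ord // => i _.
  by rewrite /dir /= odd_double.
Qed.

Lemma top_height_div : (top_height %/ k.+1 = k.*2.-1)%N.
Proof.
rewrite /top_height (_ : _.-1 = k.*2.-1 * k.+1 + k)%N; last by nia.
by rewrite divnMDl // divn_small ?addn0.
Qed.

Lemma height_route p t : (t <= top_height)%N -> height (route p t) = t.
Proof. by move=> ?; rewrite /height /= inordK ?ltnS. Qed.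

Lemma modn_pred_dvd d t : (d.+1 %| t.+1)%N -> (t %% d.+1 = d)%N.
Proof.
move=> dt; have := ltn_pmod t (ltn0Sn d).
have: (d.+1 %| (t %% d.+1).+1)%N by rewrite /dvdn -addn1 modnDml addn1.
by move/(dvdn_leq (ltn0Sn _)); lia.
Qed.

(* A walk that has made [c < k] downward steps cannot have descended a whole
   chain, so it stays next to a node reached by monotone moves: it is either on
   a chain leaving that node, or in the last [c] vertices of one entering it.
   As long as those moves are canonical, every node passed has cost a downward
   step. *)
Variant reached (p : demand) (a : vertex) (c : nat) : Prop :=
| Outgoing w of a.1.2 = pos p.1 w (layer a)
    & ((forall j, (j < layer a)%N -> w j = dir p j) ->
       ((layer a).-1 <= c)%N /\ (a.2 = dir p (layer a) -> (layer a <= c)%N))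
| Ingoing w of step (layer a) a.1.2 a.2 = pos p.1 w (layer a).+1
    & (k <= height a %% k.+1 + c)%N
    & ((forall j, (j <= layer a)%N -> w j = dir p j) ->
       (layer a <= c)%N /\ (a.2 <> w (layer a) -> (layer a < c)%N)).

Lemma reached_start p : reached p (route p 0) 0.
Proof.
have l0 : layer (route p 0) = 0%N by rewrite /layer height_route // div0n.
by apply: (@Outgoing _ _ _ (dir p)); rewrite l0 //= div0n.
Qed.

Lemma route_vertexP p a : a.1.2 = pos p.1 (dir p) (layer a) -> a.2 = dir p (layer a) ->
  a == route p (height a).
Proof.
case: a => -[h z] u /=; rewrite /layer /height /route /= => -> ->.
by rewrite inord_val.
Qed.

Lemma reached_up (x : {set demand}) p a b c : p \notin x -> kept_arc x a b ->
  reached p a c -> reached p b c.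
Proof.
move=> px /andP[/andP[/eqP hb]].
have lb : layer b = ((k.+1 %| height b) + layer a)%N by rewrite /layer hb divnS.
have mb : (height b %% k.+1 = if k.+1 %| height b then 0 else (height a %% k.+1).+1)%N.
  by rewrite hb modnS.
case: ifPn mb lb => [dv|ndv] mb /= lb; last first.
  move=> /andP[/eqP zb /eqP ub] _; rewrite add0n in lb.
  case=> w; [move=> ew H|move=> ew rc H].
  - by apply: (@Outgoing _ _ _ w); rewrite lb ?zb ?ub.
  - by apply: (@Ingoing _ _ _ w); rewrite ?lb ?zb ?ub // mb; lia.
rewrite add1n in lb; move=> /eqP zb /forallP ncrit.
(* If both ends lay on the route of [p], the arc would be critical for [p], hence deleted because
   [p] is not in [x]. *)
have {ncrit} ncrit : a.1.2 = pos p.1 (dir p) (layer a) -> a.2 = dir p (layer a) ->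
    b.2 <> dir p (layer b).
  move=> za ua ub; have := ncrit p; rewrite (negbTE px) implybF => /negP; apply.
  by rewrite /critical dv !route_vertexP //= lb /= -za -ua.
case=> w.
- move=> za Hc.
  (* Crossing the outer vertex turns the direction of the chain just climbed into the next move of
     the monotone path. *)
  pose w' j := if j == layer a then a.2 else w j.
  have ww' j : (j < layer a)%N -> w' j = w j by rewrite /w'; case: eqP => // ->; rewrite ltnn.
  apply: (@Outgoing _ _ _ w').
  + by rewrite lb /= /w' eqxx -/w' (eq_pos _ ww') -za.
  + rewrite lb /= => can.
    have ua : a.2 = dir p (layer a) by rewrite -can // /w' eqxx.
    have canw j : (j < layer a)%N -> w j = dir p j.
      by move=> jl; rewrite -ww' // can // ltnW.
    have [_ /(_ ua) lc] := Hc canw; split=> // ub.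
    by case: ncrit => //; rewrite ?za ?lb //; apply: eq_pos.
(* Here [w] already counts the node above [a]. If [b] starts the canonical chain, then [a] is off
   it, and the strict bound applies. *)
- move=> za rc Hc; apply: (@Outgoing _ _ _ w); rewrite lb ?zb //= => can.
  have [lc lc'] := Hc can; split=> // ub; apply: lc' => ua.
  have can' j : (j < layer a)%N -> w j = dir p j by move=> jl; apply: can; apply: ltnW.
  case: ncrit; rewrite ?lb ?ua ?can //.
  by move: za; rewrite /= ua => /step_inj ->; apply: eq_pos.
Qed.

Lemma reached_down p a b c : arc b a -> (c < k)%N -> reached p a c -> reached p b c.+1.
Proof.
move=> /andP[/eqP ha] + ck.
have la : layer a = ((k.+1 %| height a) + layer b)%N by rewrite /layer ha divnS.
have ma : (height a %% k.+1 = if k.+1 %| height a then 0 else (height b %% k.+1).+1)%N.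
  by rewrite ha modnS.
case: ifPn ma la => [dv|ndv] ma /= la; last first.
  move=> /andP[/eqP zb /eqP ub]; rewrite add0n in la.
  case=> w; [move=> + H|move=> + rc H]; rewrite la ub zb in H * => ew.
  - by apply: (@Outgoing _ _ _ w) => // /H[]; split; lia.
  - by apply: (@Ingoing _ _ _ w) => // [|/H[]]; first lia; split; lia.
(* At a chain start the ingoing case would give [k <= c], which is excluded. *)
move=> /eqP za; rewrite add1n in la; case=> w; last by rewrite ma; lia.
rewrite za la => zb H; apply: (@Ingoing _ _ _ w) => //.
- by rewrite ha in dv; rewrite (modn_pred_dvd dv) leq_addr.
- by move=> /H[]; split; lia.
Qed.

(** * Walks and their downward steps *)

Lemma kept_edge_height x a b : kept_edge x a b ->
  (height b = (height a).+1 \/ height a = (height b).+1)%N.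
Proof. by case/orP => /andP[/andP[/eqP-> _] _]; [left|right]. Qed.

Lemma height_last x a q : path (kept_edge x) a q ->
  (height (last a q) <= height a + size q)%N.
Proof.
elim: q a => [|b q IH] a /=; first by rewrite addn0.
case/andP=> /kept_edge_height h1 /IH h2; case: h1 h2 => ->; lia.
Qed.

(** The length of a walk is its gain in height plus twice its number of downward steps, so the
    strict inequality says that the final count [c'] stays below [k], as [reached_down] needs along
    the way. *)
Lemma reached_walk (x : {set demand}) p a q c :
  p \notin x -> path (kept_edge x) a q -> reached p a c ->
  (height a + 2 * c + size q < height (last a q) + 2 * k)%N ->
  exists2 c', reached p (last a q) c' &
    (height a + 2 * c + size q = height (last a q) + 2 * c')%N.
Proof.
move=> px; elim: q a c => [|b q IH] a c /=; first by exists c; rewrite ?addn0.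
case/andP=> ab bq ra; have hl := height_last bq; have hab := kept_edge_height ab.
case/orP: (ab) => arc_ab; have /andP[/andP[/eqP hb _] _] := arc_ab.
- move=> lt; have [||c' rc' e] := IH b c bq; first exact: reached_up px arc_ab ra.
    by lia.
  by exists c' => //; lia.
- move=> lt; have [||c' rc' e] := IH b c.+1 bq.
  + by apply: (reached_down _ _ ra); [case/andP: arc_ab|lia].
  + by lia.
  + by exists c' => //; lia.
Qed.

Lemma walk_avoiding_demand (x : {set demand}) p q :
  p \notin x -> path (kept_edge x) (route p 0) q ->
  last (route p 0) q = route p top_height -> (top_height + k < size q)%N.
Proof.
move=> px pq lq; rewrite ltnNge; apply/negP => le.
have := reached_walk px pq (reached_start p).
rewrite lq !height_route // muln0 !add0n.
case=> [|c' rc' e]; first by lia.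
(* The assumed length gives [2 * c' <= k], whereas canonical moves force a downward step for each of
   the [2 * k - 1] crossings. *)
suff: (k.*2.-1 <= c')%N by lia.
have lt : layer (route p top_height) = k.*2.-1.
  by rewrite /layer height_route // top_height_div.
have k2 : k.*2.-1.+1 = k.*2 by lia.
case: rc' => w; rewrite lt /= top_height_div.
(* Only [2 * k - 1] moves are complete on the last chain; [w'] appends the direction of that chain
   to reach the length at which convexity applies. *)
- move=> zt H; pose w' j := if (j < k.*2.-1)%N then w j else dir p j.
  have ww' j : (j < k.*2.-1)%N -> w' j = w j by rewrite /w' => ->.
  have can : forall j, (j < k.*2)%N -> w' j = dir p j.
    apply: pos_convex; rewrite -k2 /= /w' ltnn -/w'; congr step.
    by rewrite (eq_pos _ ww').
  have canw j : (j < k.*2.-1)%N -> w j = dir p j.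
    by move=> jk; rewrite -ww' // can //; lia.
  by have [_ ->] := H canw.
- move=> zt _ H; have can : forall j, (j < k.*2)%N -> w j = dir p j.
    by apply: pos_convex; rewrite -k2 /= -zt.
  by have [] := H (fun j jk => can j ltac:(lia)).
Qed.

(** The chains on the two sides of a critical edge have directions [u] and [v], in an order fixed by
    parity, so they recover both; injectivity of [pos] then recovers the start. *)
Lemma critical_route p p' t : (t < top_height)%N ->
  critical p' (route p t) (route p t.+1) -> p' = p.
Proof.
move=> tT /and3P[]; rewrite (height_route p tT) (height_route p (ltnW tT)) => dv.
move=> /eqP[+ e1] /eqP[_].
rewrite divnS // dv add1n => + e2.
have e : p.2 = p'.2.
  by move: e1 e2; rewrite /dir /=; case: (odd _) => /=; case: p.2 p'.2 => [? ?] [? ?] /= -> ->.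
have ed i : dir p i = dir p' i by rewrite /dir e.
rewrite (eq_pos _ (fun j _ => ed j)) => /pos_inj; case: p p' e {e1 e2 ed} => [? ?] [? ?] /=.
by move=> -> ->.
Qed.

Lemma route_walk (x : {set demand}) p : p \in x ->
  exists2 q, path (kept_edge x) (route p 0) q &
  last (route p 0) q = route p top_height /\ size q = top_height.
Proof.
move=> px; have: (top_height <= top_height)%N by [].
move: {1 3 4}top_height => t; elim: t => [|t IH] tT; first by exists [::].
have [q pq [lq sq]] := IH (ltnW tT).
exists (rcons q (route p t.+1)); last by rewrite last_rcons size_rcons sq.
rewrite rcons_path pq lq /=; apply/orP; left; apply/andP; split; last first.
  by apply/forallP => p'; apply/implyP => /(critical_route tT) ->.
rewrite /arc /layer (height_route p tT) (height_route p (ltnW tT)) eqxx /= divnS //.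
by case: (k.+1 %| t.+1)%N; rewrite ?add1n ?add0n /= !eqxx.
Qed.

Lemma card_vertex : #|{: vertex}| = (2 * k * k.+1 * #|Z| ^ 2 * #|U|)%N.
Proof. by rewrite !card_prod card_ord /top_height prednK ?mulnn //; nia. Qed.

Lemma card_demand : #|{: demand}| = (#|Z| ^ 2 * #|U| ^ 2)%N.
Proof. by rewrite !card_prod !mulnn. Qed.

End ObstacleProduct.

(** * Distances and communication cost *)

Lemma dist_le (R : realType) n (E : edge_set n) u v p :
  path (adj E) u p -> last u p = v -> (dist R E u v <= (size p)%:R%:E)%E.
Proof.
by move=> pp lp; apply: ereal_inf_lbound; exists p => //=; rewrite pp lp eqxx.
Qed.

Lemma dist_ge (R : realType) n (E : edge_set n) u v m :
  (forall p, path (adj E) u p -> last u p = v -> (m <= size p)%N) ->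
  (m%:R%:E <= dist R E u v)%E.
Proof.
move=> H; apply: le_ereal_inf_tmp => _ [p /= /andP[pp /eqP lp] <-].
by rewrite lee_fin ler_nat H.
Qed.

(** If every walk in [H] were longer, integrality of lengths would put the infimum at
    [size p + k + 1] or above. *)
Lemma additive_spanner_walk (R : realType) n k (G H : edge_set n) u v p :
    additive_spanner R k G H -> path (adj G) u p -> last u p = v ->
  exists2 q, path (adj H) u q & last u q = v /\ (size q <= size p + k)%N.
Proof.
case/andP=> _ /forallP/(_ u)/forallP/(_ v) Huv pp lp.
apply: contrapT => nq.
have: ((size p + k).+1%:R%:E <= dist R H u v)%E.
  apply: dist_ge => q qq lq; rewrite ltnNge; apply/negP => qle.
  by apply: nq; exists q.
apply/negP; rewrite -ltNge; apply: le_lt_trans Huv _.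
apply: le_lt_trans (leeD2r _ (dist_le R pp lp)) _.
by rewrite -EFinD lte_fin -natrD ltr_nat.
Qed.

(** * Transport of a relation to a graph on ['I_n] *)

Section Embedding.
Variables (T : finType) (n : nat) (f : T -> 'I_n) (f_inj : injective f).

Definition embed (e : rel T) : edge_set n :=
  [set [set f ab.1; f ab.2] | ab in [set ab : T * T | e ab.1 ab.2]]%SET.

Lemma embed_adj (e : rel T) a b : e a b -> adj (embed e) (f a) (f b).
Proof. by move=> ab; apply/imsetP; exists (a, b); rewrite ?inE. Qed.

Lemma adj_embed (e : rel T) a v : symmetric e -> adj (embed e) (f a) v ->
  exists2 b, v = f b & e a b.
Proof.
move=> e_sym /imsetP[[b c]]; rewrite inE /= => bc /setP eq_ab.
have fa := eq_ab (f a); have fv := eq_ab v; have fb := eq_ab (f b); have fc := eq_ab (f c).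
move: fa fv fb fc; rewrite !inE !eqxx ?orbT /=.
move=> /esym/orP[]/eqP/f_inj -> /esym/orP[]/eqP ->; rewrite ?eqxx ?orbT ?orbb /=.
- by move=> _ /eqP/f_inj cb; exists b => //; rewrite -{2}cb.
- by exists c.
- by exists b; rewrite // e_sym.
- by move=> /eqP/f_inj cb _; exists c => //; rewrite -{1}cb.
Qed.

Lemma embed_path (e : rel T) a p : path e a p -> path (adj (embed e)) (f a) (map f p).
Proof. by rewrite path_map; apply: sub_path => x y; apply: embed_adj. Qed.

Lemma path_embed (e : rel T) a q : symmetric e -> path (adj (embed e)) (f a) q ->
  exists2 p, path e a p & q = map f p.
Proof.
move=> e_sym; elim: q a => [|v q IH] a /=; first by exists [::].
case/andP=> /(adj_embed e_sym)[b -> ab] /IH[p bp ->].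
by exists (b :: p) => //=; rewrite ab.
Qed.

Lemma embed_simple (e : rel T) : irreflexive e -> simple (embed e).
Proof.
move=> e_irr; apply/forall_inP => _ /imsetP[[a b] + ->]; rewrite inE /= cards2 => ab.
by rewrite (inj_eq f_inj); case: (eqVneq a b) ab => // ->; rewrite e_irr.
Qed.

End Embedding.

(** * Deterministic protocol trees *)

Section Protocols.
Variables (s : nat) (X : finType) (Y : Type).
Implicit Types (P : protocol s X Y).

(** Distinct inputs of [A] end at distinct leaves of a binary tree; the induction splits [A] by the
    first bit written. *)
Lemma card_le_bits P (A : {set {ffun 'I_s -> X}}) C :
    (forall x, x \in A -> (bits P x <= C)%N) ->
    {in A &, injective (fun x : {ffun 'I_s -> X} => output P x)} ->
  (#|A| <= 2 ^ C)%N.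
Proof.
elim: P A C => [y|i b next IH] A C /= bA injA.
  apply: leq_trans (_ : 1 <= _)%N; last by rewrite expn_gt0.
  by apply/card_le1_eqP => x x' xA x'A; apply: injA.
have [->|[x0 x0A]] := set_0Vmem A; first by rewrite cards0.
case: C bA => [|C] bA; first by have := bA _ x0A.
pose B c := [set x in A | b (x i) == c]%SET.
have leB c : (#|B c| <= 2 ^ C)%N.
  apply: (IH c) => [x|x x']; first by rewrite inE => /andP[/bA + /eqP <-].
  rewrite !inE => /andP[xA /eqP bx] /andP[x'A /eqP bx'] e.
  by apply: injA; rewrite // bx bx'.
rewrite (_ : A = B true :|: B false)%SET.
  by apply: leq_trans (leq_card_setU _ _) _; rewrite expnS mul2n -addnn leq_add.
by apply/setP => x; rewrite !inE -andb_orr; case: (b _); rewrite andbT.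
Qed.

Fixpoint writes P (x : 'I_s -> X) (i : 'I_s) : bool :=
  if P is Write j b next then (i == j) || writes (next (b (x j))) x i else false.

(** The run consults the input of a site only when that site writes. *)
Lemma writesPn P (x y : 'I_s -> X) i :
  (forall j, j != i -> y j = x j) -> ~~ writes P x i -> output P y = output P x.
Proof.
move=> xy; elim: P => //= j b next IH; rewrite negb_or => /andP[ij nw].
by rewrite xy 1?eq_sym // IH.
Qed.

Lemma sum_writes P x : (\sum_i writes P x i <= bits P x)%N.
Proof.
elim: P => [y|j b next IH] /=; first by rewrite big1.
apply: leq_trans (_ : \sum_i ((i == j) + writes (next (b (x j))) x i) <= _)%N.
  by apply: leq_sum => i _; case: eqP; case: writes.
by rewrite big_split /= (bigD1 j) //= eqxx big1 ?addn0 ?add1n ?ltnS // => i /negbTE ->.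
Qed.

End Protocols.

(** * Averaging over the public coins *)

Section Randomized.
Variables (R : realType) (s : nat) (X : finType) (Y : Type).
Variables (valid : pred {ffun 'I_s -> X}) (correct : {ffun 'I_s -> X} -> Y -> bool).
Variables (eps : R) (P : rand_protocol R s X Y).
Hypothesis P_solves : solves valid correct eps P.
Let cost := comm_cost valid P.

Lemma bits_le_cost (w : seed P) x : valid x -> (bits (det_protocol w) x <= cost)%N.
Proof.
move=> vx; apply: leq_trans (leq_bigmax w).
by apply: (@leq_bigmax_cond _ _ (fun x : {ffun _} => bits (det_protocol w) x)).
Qed.

(** Each seed is right on at most [2 ^ cost] instances, while the average over seeds exceeds half of
    the [2 ^ N]. Since [2 ^ N.-1] is already too few, no bit is lost. *)
Lemma cost_ge_log (I : finType) (F : I -> {ffun 'I_s -> X}) (N : nat) :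
    eps < 1 / 2 -> #|I| = (2 ^ N)%N -> (forall i, valid (F i)) ->
    (forall i j y, correct (F i) y -> correct (F j) y -> i = j) ->
  (N <= cost)%N.
Proof.
move=> eps_lt cI vF F_sep; rewrite leqNgt; apply/negP => ltN.
pose out (w : seed P) i := output (det_protocol w) (F i).
have count (w : seed P) : (#|[set i | correct (F i) (out w i)]%SET| <= 2 ^ cost)%N.
  rewrite -(card_in_imset (f := F)); last first.
    move=> i j; rewrite !inE /out => ci cj eF; apply: F_sep ci _.
    by rewrite eF.
  apply: (@card_le_bits _ _ _ (det_protocol w)).
    by move=> _ /imsetP[i _ ->]; apply: bits_le_cost.
  move=> _ _ /imsetP[i + ->] /imsetP[j + ->]; rewrite !inE /out => ci cj e.
  by congr F; apply: F_sep ci _; rewrite e.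
have: \sum_(i : I) (1 - eps) <= (2 ^ cost)%N%:R :> R.
  apply: le_trans (_ : \sum_(i : I) \sum_(w | correct (F i) (out w i)) weight w <= _).
    by apply: ler_sum => i _; apply: P_solves.
  rewrite (exchange_big_dep xpredT) //=.
  apply: le_trans (_ : \sum_(w : seed P) weight w * (2 ^ cost)%N%:R <= _).
    apply: ler_sum => w _; rewrite sumr_const -[leLHS]mulr_natr ler_wpM2l ?weight_ge0 //.
    by rewrite ler_nat; apply: leq_trans (count w); rewrite cardsE.
  by rewrite -mulr_suml weight_sum1 mul1r.
rewrite sumr_const cI; apply/negP; rewrite -ltNge.
have: (2 * 2 ^ cost <= 2 ^ N)%N by rewrite -expnS leq_exp2l.
have: (0 < 2 ^ cost)%N by rewrite expn_gt0.
move: (2 ^ cost)%N (2 ^ N)%N => a b; rewrite -(ltr0n R) -(ler_nat R) natrM => a_gt0 ab.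
rewrite -mulr_natr; nra.
Qed.

Lemma cost_ge_sites (x0 : {ffun 'I_s -> X}) (x1 : 'I_s -> {ffun 'I_s -> X}) :
    valid x0 -> (forall i, valid (x1 i)) ->
    (forall i j, j != i -> x1 i j = x0 j) ->
    (forall i y, correct x0 y -> correct (x1 i) y -> false) ->
  (1 - 2 * eps) * s%:R <= cost%:R.
Proof.
move=> v0 v1 x10 sep.
pose out (w : seed P) x := output (det_protocol w) x.
pose wr (w : seed P) i := writes (det_protocol w) x0 i.
have spoken i : 1 - 2 * eps <= \sum_w weight w * (wr w i)%:R.
  have h1 := P_solves (v1 i); have h0 := P_solves v0.
  rewrite big_mkcond /= in h1; rewrite big_mkcond /= in h0.
  have := lerD h1 h0; rewrite -big_split /= => h.
  rewrite (_ : 1 - 2 * eps = 1 - eps + (1 - eps) - 1); last by lra.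
  rewrite lerBlDr; apply: le_trans h _.
  rewrite -[leRHS]/(_ + 1) -[X in _ + X](weight_sum1 P) -big_split /=.
  (* For a fixed seed, being right on both inputs forces site [i] to write, because a silent site
     leaves the output unchanged. *)
  apply: ler_sum => w _; have w0 := weight_ge0 w.
  case: ifP => [c1|_]; case: ifP => [c0|_];
    rewrite ?addr0 ?add0r ?lerDr ?addr_ge0 ?mulr_ge0 //.
  rewrite lerD2r /wr; case wwi: (writes _ _ _); rewrite ?mulr1 //.
  have e : output (det_protocol w) (x1 i) = output (det_protocol w) x0.
    by apply: (writesPn (i := i)) => [j|]; [exact: x10|rewrite wwi].
  by have := sep i _ c0; rewrite -e => /(_ c1).
have -> : (1 - 2 * eps) * s%:R = \sum_(i < s) (1 - 2 * eps).
  by rewrite sumr_const card_ord mulr_natr.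
apply: le_trans (_ : \sum_(i < s) \sum_w weight w * (wr w i)%:R <= _).
  by apply: ler_sum.
rewrite exchange_big /=.
apply: le_trans (_ : \sum_(w : seed P) weight w * cost%:R <= _).
  apply: ler_sum => w _; rewrite -mulr_sumr -natr_sum ler_wpM2l ?weight_ge0 // ler_nat.
  by apply: leq_trans (sum_writes _ _) (bits_le_cost w v0).
by rewrite -mulr_suml weight_sum1 mul1r.
Qed.

End Randomized.

(** * Lower bounds *)

Section SpannerCost.
Variables (k : nat) (Z : finZmodType) (U : finType) (phi : U -> Z).
Hypothesis k_gt0 : (0 < k)%N.
Hypothesis phi_convex : forall (u : U) (w : nat -> U),
  \sum_(j < k) phi (w j) = phi u *+ k -> forall j, (j < k)%N -> w j = u.
Variables (n : nat) (f : vertex k Z U -> 'I_n).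
Hypothesis f_inj : injective f.

Let G (x : {set demand Z U}) : edge_set n := embed f (kept_edge phi x).

Lemma kept_edge_sym x : symmetric (@kept_edge k Z U phi x).
Proof. by move=> a b; rewrite /kept_edge orbC. Qed.

Lemma kept_edge_irr x : irreflexive (@kept_edge k Z U phi x).
Proof.
move=> a; apply: contraTF isT => /kept_edge_height h.
by exfalso; case: h; lia.
Qed.

(** For a demand in [x] but not in [x'], [H] would contain a walk of length at most
    [top_height + k]; this walk lies in [G x'], against [walk_avoiding_demand]. *)
Lemma common_spanner_subset (R : realType) x x' H :
  additive_spanner R k (G x) H -> additive_spanner R k (G x') H -> x \subset x'.
Proof.
move=> spx /andP[Hx' _]; apply/fintype.subsetP => p px; apply: contraT => px'.
have [q pq [lq sq]] := route_walk k phi px.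
have := additive_spanner_walk spx (embed_path f pq) (erefl _).
rewrite last_map lq size_map sq => -[q' pq' [lq' sq']].
have : path (adj (G x')) (f (route k phi p 0)) q'.
  by apply: sub_path pq' => u v; apply: (fintype.subsetP Hx').
case/(path_embed f_inj (@kept_edge_sym x')) => r pr eq'.
have /= := walk_avoiding_demand k_gt0 phi_convex px' pr.
have -> : last (route k phi p 0) r = route k phi p (top_height k).
  by apply: f_inj; rewrite -lq' eq' last_map.
by move=> /(_ erefl); rewrite ltnNge -(size_map f) -eq' sq'.
Qed.

Lemma spanner_cost_ge (R : realType) (eps : R) s
    (P : rand_protocol R s.+1 (edge_set n) (edge_set n)) :
    eps < 1 / 2 ->
    solves (@no_duplication n s.+1)
      (fun x H => additive_spanner R k (union_graph x) H) eps P ->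
  (#|{: demand Z U}| <= comm_cost (@no_duplication n s.+1) P)%N.
Proof.
move=> eps_lt solP.
pose F x : {ffun 'I_s.+1 -> edge_set n} := [ffun i => if i == ord0 then G x else finset.set0].
have uF x : union_graph (F x) = G x.
  rewrite /union_graph (bigD1 ord0) //= ffunE eqxx big1 ?finset.setU0 // => i /negbTE i0.
  by rewrite ffunE i0.
apply: (cost_ge_log solP (F := F)) => //.
- by rewrite -cardsT -powersetT card_powerset cardsT.
- move=> x; apply/andP; split.
    apply/forallP => i; rewrite ffunE; case: ifP => _.
      exact: (embed_simple f_inj (@kept_edge_irr x)).
    by apply/forall_inP => e; rewrite inE.
  apply/forallP => i; apply/forallP => j; apply/implyP => ij.
  rewrite !ffunE; case: eqP => [i0|_]; last by rewrite -setI_eq0 finset.set0I.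
  case: eqP => [j0|_]; last by rewrite -setI_eq0 finset.setI0.
  by rewrite i0 j0 eqxx in ij.
- move=> x x' H; rewrite !uF => spx spx'.
  by apply/eqP; rewrite finset.eqEsubset !(common_spanner_subset (H := H) (R := R)).
Qed.

End SpannerCost.

Lemma Zp_natr_inj (m x y : nat) : (x < m)%N -> (y < m)%N -> (1 < m)%N ->
  x%:R = y%:R :> 'Z_m -> x = y.
Proof. by move=> xm ym m1 /(congr1 val); rewrite /= !val_Zp_nat // !modn_small. Qed.

(** * Directions on a paraboloid over a finite group *)

Section Paraboloid.
Variables (k D b : nat).
Hypotheses (k_gt1 : (1 < k)%N) (D_gt0 : (0 < D)%N) (b_gt0 : (0 < b)%N).

(** The moduli exceed every sum of [k] digits below [b] and every sum of [k] squared norms, so the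
    equations used in the group hold between integers. *)
Definition grid := ('rV['Z_(k * b)]_D * 'Z_(k * (D * b ^ 2)))%type.
HB.instance Definition _ := Finite.on grid.
HB.instance Definition _ := GRing.Zmodule.on grid.

Definition direction : finType := {ffun 'I_D -> 'I_b}.

Definition sqnorm (u : direction) : nat := (\sum_i u i ^ 2)%N.

Definition lift_paraboloid (u : direction) : grid :=
  (\row_i (u i)%:R, (sqnorm u)%:R).

Lemma sum_lt_mul (a : 'I_k -> nat) m : (forall j, (a j < m)%N) -> (\sum_j a j < k * m)%N.
Proof.
move=> am; have m_gt0 : (0 < m)%N.
  by apply: leq_trans (am (Ordinal (ltnW k_gt1))).
apply: leq_ltn_trans (_ : \sum_(j < k) m.-1 < _)%N.
  by apply: leq_sum => j _; have := am j; lia.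
by rewrite sum_nat_const card_ord; nia.
Qed.

Lemma sqnorm_lt u : (sqnorm u < D * b ^ 2)%N.
Proof.
apply: leq_ltn_trans (_ : \sum_(j < D) (b ^ 2).-1 < _)%N.
  apply: leq_sum => i _; have : (u i ^ 2 < b ^ 2)%N by rewrite ltn_exp2r.
  by lia.
rewrite sum_nat_const card_ord; have : (0 < b ^ 2)%N by rewrite expn_gt0 b_gt0.
by nia.
Qed.

(* Equality in [2 w u <= w ^ 2 + u ^ 2], summed over all coordinates. *)
Lemma lift_paraboloid_convex (u : direction) (w : nat -> direction) :
    \sum_(j < k) lift_paraboloid (w j) = lift_paraboloid u *+ k ->
  forall j, (j < k)%N -> w j = u.
Proof.
have kb_gt1 : (1 < k * b)%N by nia.
have b2_gt0 : (0 < b ^ 2)%N by rewrite expn_gt0 b_gt0.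
have kDb_gt1 : (1 < k * (D * b ^ 2))%N by nia.
rewrite -[in RHS](card_ord k) -sumr_const => e.
have e1 i : (\sum_(j < k) w j i = k * u i)%N.
  apply: (@Zp_natr_inj (k * b)) => //.
  - by apply: sum_lt_mul.
  - by rewrite ltn_pmul2l // ltnW.
  have /rowP/(_ i) := congr1 fst e.
  rewrite (raddf_sum fst) /= (raddf_sum fst) /= !summxE.
  move=> h; have : \sum_(j < k) (w j i)%:R = \sum_(j in 'I_k) (u i)%:R :> 'Z_(k * b).
    by apply: (etrans _ (etrans h _)); apply: eq_bigr => j _; rewrite mxE.
  by rewrite sumr_const card_ord natr_sum natrM mulr_natl.
have e2 : (\sum_(j < k) sqnorm (w j) = k * sqnorm u)%N.
  apply: (@Zp_natr_inj (k * (D * b ^ 2))) => //.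
  - by apply: sum_lt_mul => j; apply: sqnorm_lt.
  - by rewrite ltn_pmul2l ?sqnorm_lt // ltnW.
  have := congr1 snd e; rewrite (raddf_sum snd) /= (raddf_sum snd) /=.
  by rewrite sumr_const card_ord natr_sum natrM mulr_natl.
have [_] : (\sum_(j < k) \sum_i 2 * (w j i * u i)
    <= \sum_(j < k) \sum_i (w j i ^ 2 + u i ^ 2)
    ?= iff [forall (j : 'I_k | true), [forall (i | true), w j i == u i :> nat]])%N.
  by apply: leqif_sum => j _; apply: leqif_sum => i _; exact: nat_Cauchy.
have -> : (\sum_(j < k) \sum_i 2 * (w j i * u i) = 2 * (k * sqnorm u))%N.
  rewrite exchange_big /= !big_distrr /=; apply: eq_bigr => i _.
  by rewrite -big_distrr -big_distrl /= e1; ring.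
have -> : (\sum_(j < k) \sum_i (w j i ^ 2 + u i ^ 2) = 2 * (k * sqnorm u))%N.
  under eq_bigr do rewrite big_split /=.
  by rewrite big_split /= e2 sum_nat_const card_ord mul2n addnn.
rewrite eqxx => /esym/forallP/= all_eq j jk; apply/ffunP => i; apply/val_inj/eqP.
by have /forallP/(_ i) := all_eq (Ordinal jk).
Qed.

Lemma card_grid : #|{: grid}| = ((k * b) ^ D * (k * (D * b ^ 2)))%N.
Proof. by rewrite card_prod card_mx mul1n !card_ord !Zp_cast //; nia. Qed.

Lemma card_vertex_paraboloid :
  #|{: vertex k grid direction}| =
  (2 * k * k.+1 * ((k * b) ^ D * (k * (D * b ^ 2))) ^ 2 * b ^ D)%N.
Proof.
by rewrite card_vertex ?card_grid ?card_ffun ?card_ord // ltnW.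
Qed.

Lemma card_demand_paraboloid :
  (b ^ (4 * D + 4) <= #|{: demand grid direction}|)%N.
Proof.
rewrite card_demand card_grid card_ffun !card_ord.
rewrite (_ : b ^ _ = (b ^ D * b ^ 2) ^ 2 * (b ^ D) ^ 2)%N; last first.
  by rewrite -expnD -!expnM -expnD; congr expn; lia.
rewrite leq_mul // leq_exp2r // leq_mul // ?leq_exp2r //; first by nia.
by rewrite mulnA leq_pmull // muln_gt0 D_gt0 ltnW.
Qed.

End Paraboloid.

(** * Choice of parameters and the exponent *)

Lemma exists_base_between (c q : nat) : exists N : nat, forall n, (N <= n)%N ->
  exists2 b : nat, (0 < b)%N & (c * b ^ q <= n <= b ^ q.+2)%N.
Proof.
(* The base [b] will be the largest with [b ^ q.+1 <= n]. The threshold makes it at least [c] and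
   [2 ^ q.+1], whence [c * b ^ q <= b ^ q.+1] and [b.+1 ^ q.+1 <= (2 * b) ^ q.+1 <= b ^ q.+2]. *)
pose m := maxn c (2 ^ q.+1); exists (m ^ q.+1)%N => n mn.
have b_ex : exists b, (b ^ q.+1 <= n)%N by exists m.
have b_max b : (b ^ q.+1 <= n)%N -> (b <= n)%N.
  by apply: leq_trans; case: b => // b; rewrite -[X in (X <= _)%N]expn1 leq_pexp2l.
case: (ex_maxnP b_ex b_max) => b bn maxb.
have mb : (m <= b)%N := maxb _ mn.
have [cb eb] : (c <= b)%N /\ (2 ^ q.+1 <= b)%N by apply/andP; rewrite -geq_max.
have b_gt0 : (0 < b)%N by apply: leq_trans eb; rewrite expn_gt0.
exists b => //; apply/andP; split.
  by apply: leq_trans bn; rewrite expnS leq_mul.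
have: (n < b.+1 ^ q.+1)%N.
  by rewrite ltnNge; apply/negP => /maxb; rewrite ltnn.
move/ltnW/leq_trans; apply.
apply: leq_trans (_ : (2 * b) ^ q.+1 <= _)%N; first by rewrite leq_exp2r //; lia.
by rewrite expnMn [in leqRHS]expnS leq_mul.
Qed.

Lemma spanner_cost_ge_powR (R : realType) (k D : nat) (eps : R) :
  (1 < k)%N -> eps < 1 / 2 -> exists N : nat, forall n s : nat, (N <= n)%N ->
  forall P : rand_protocol R s.+1 (edge_set n) (edge_set n),
    solves (@no_duplication n s.+1)
      (fun x H => additive_spanner R k (union_graph x) H) eps P ->
  n%:R `^ (4 / 3 - 4 / 3 / D.+3%:R) <= (comm_cost (@no_duplication n s.+1) P)%:R :> R.
Proof.
move=> k_gt1 eps_lt.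
(* The factors of the vertex count in dimension [D.+1] that are free of [b]; the rest is
   [b ^ (3 * D.+1 + 4)]. *)
pose c := (2 * k * k.+1 * (k ^ D.+1 * (k * D.+1)) ^ 2)%N.
have [N HN] := exists_base_between c (3 * D.+1 + 4).
exists N => n s /HN[b b_gt0 /andP[le_n ge_n]] P solP.
have cardV : (#|{: vertex k (grid k D.+1 b) (direction D.+1 b)}| <= n)%N.
  rewrite card_vertex_paraboloid //; apply: leq_trans le_n; apply: eq_leq.
  rewrite /c (expnMn k b) (_ : b ^ (3 * _ + 4) = (b ^ D.+1 * b ^ 2) ^ 2 * b ^ D.+1)%N; first by ring.
  by rewrite -!expnD -expnM -expnD; congr expn; lia.
pose f (a : vertex k (grid k D.+1 b) (direction D.+1 b)) := widen_ord cardV (enum_rank a).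
have f_inj : injective f by move=> a a' /(congr1 val)/= /ord_inj/enum_rank_inj.
have /(leq_trans (card_demand_paraboloid k_gt1 (ltn0Sn D) b_gt0)) cost_ge :=
  spanner_cost_ge (ltnW k_gt1) (lift_paraboloid_convex k_gt1 (ltn0Sn D) b_gt0) f_inj eps_lt solP.
apply: le_trans (_ : (b ^ (4 * D.+1 + 4))%:R <= _); last by rewrite ler_nat.
have D3 : D.+3%:R != 0 :> R by rewrite pnatr_eq0.
(* The exponent of [b] in the bound on demands, over its exponent in the upper bound on [n]. *)
have e : 4 / 3 - 4 / 3 / D.+3%:R = (4 * D.+1 + 4)%:R / (3 * D.+1 + 4).+2%:R :> R.
  rewrite (_ : (3 * D.+1 + 4).+2 = 3 * D.+3)%N; last by lia.
  rewrite (_ : 4 * D.+1 + 4 = 4 * D.+3 - 4)%N; last by lia.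
  rewrite natrB; last by lia.
  by rewrite !natrM; field.
rewrite e; apply: le_trans (_ : (b ^ (3 * D.+1 + 4).+2)%:R `^ _ <= _).
  by apply: ge0_ler_powR; rewrite ?nnegrE ?divr_ge0 ?ler_nat.
rewrite !natrX -!powR_mulrn // -powRrM mulrCA divff ?mulr1 //.
Qed.

Lemma sites_cost_ge (R : realType) (k : nat) (eps : R) (n s : nat) :
  (1 < n)%N -> forall P : rand_protocol R s (edge_set n) (edge_set n),
    solves (@no_duplication n s)
      (fun x H => additive_spanner R k (union_graph x) H) eps P ->
  (1 - 2 * eps) * s%:R <= (comm_cost (@no_duplication n s) P)%:R.
Proof.
move=> n_gt1 P solP.
pose u := Ordinal (ltnW n_gt1); pose v := Ordinal n_gt1.
pose x0 : {ffun 'I_s -> edge_set n} := [ffun=> finset.set0].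
pose x1 i : {ffun 'I_s -> edge_set n} :=
  [ffun j => if j == i then [set [set u; v]]%SET else finset.set0].
have simple0 : simple (finset.set0 : edge_set n) by apply/forall_inP => e; rewrite inE.
apply: (cost_ge_sites solP (x0 := x0) (x1 := x1)).
- apply/andP; split; apply/forallP => i; rewrite ?ffunE //.
  by apply/forallP => j; rewrite !ffunE -setI_eq0 finset.set0I eqxx implybT.
- move=> i; apply/andP; split; apply/forallP => j.
    rewrite ffunE; case: ifP => // _; apply/forall_inP => e; rewrite inE => /eqP ->.
    by rewrite cards2.
  apply/forallP => j'; rewrite !ffunE; apply/implyP => jj'.
  case: eqP => [ji|_]; last by rewrite -setI_eq0 finset.set0I.
  case: eqP => [j'i|_]; last by rewrite -setI_eq0 finset.setI0.
  by rewrite ji j'i eqxx in jj'.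
- by move=> i j ji; rewrite !ffunE (negbTE ji).
(* A spanner of the empty graph is empty, so it leaves the ends of the single edge disconnected. *)
- move=> i H /andP[+ _].
  have -> : union_graph x0 = finset.set0.
    by rewrite /union_graph big1 // => j _; rewrite ffunE.
  rewrite finset.subset0 => /eqP -> spH.
  have uv : path (adj (union_graph (x1 i))) u [:: v].
    rewrite /= andbT; apply/finset.bigcupP; exists i => //.
    by rewrite ffunE eqxx inE.
  have [[|w q] /=] := additive_spanner_walk spH uv (erefl v); last by rewrite /adj inE.
  by move=> _ [/(congr1 val)].
Qed.

Theorem theorem15 (R : realType) (k : nat) (hk : (2 <= k)%N)
    (eps : R) (heps0 : 0 < eps) (heps : eps < 1 / 2) :
  exists (o : nat -> R) (c : R) (n0 : nat),
    [/\ o @ \oo --> (0 : R),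
        0 < c
      & forall n s : nat, (n0 <= n)%N -> (1 <= s)%N ->
          ((c * (s%:R + n%:R `^ (4 / 3 - o n)))%:E
             <= spanner_complexity k eps n s)%E].
Proof.
have [N HN] := choice (fun D => spanner_cost_ge_powR D hk heps).
(* Diagonal choice: the largest dimension index up to [n] whose threshold [n] has passed. It tends
   to infinity, which gives a single error function. *)
pose best n := (\max_(D < n.+1 | (N D <= n)%N) D)%N.
have best_ge D n : (D <= n)%N -> (N D <= n)%N -> (D <= best n)%N.
  rewrite -ltnS => Dn ND.
  exact: (@leq_bigmax_cond _ (fun D : 'I_n.+1 => N D <= n)%N (fun D => val D) (Ordinal Dn)).
(* The constant is half of [1 - 2 * eps], since the two bounds are averaged and this factor is below
   1. *)
exists (fun n => 4 / 3 / (best n).+3%:R), ((1 - 2 * eps) / 2), (maxn (N 0%N) 2); split.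
- apply/cvgr0Pnorm_lt => e e_gt0.
  have [D0 D0e] : exists D0 : nat, 4 / e < D0%:R.
    by exists (Num.bound (4 / e)); apply: archi_boundP; rewrite divr_ge0 ?ltW.
  exists (maxn D0 (N D0)) => // n /=; rewrite geq_max => /andP[D0n ND0n].
  have := best_ge _ _ D0n ND0n; rewrite -(ler_nat R) => le.
  have b_gt0 : 0 < (best n).+3%:R :> R by rewrite ltr0n.
  rewrite ger0_norm ?divr_ge0 // ltr_pdivrMr //.
  have : 4 / e < (best n).+3%:R.
    apply: lt_le_trans D0e _; apply: le_trans le _; rewrite ler_nat; lia.
  by rewrite ltr_pdivrMr // mulrC; lra.
- by lra.
- move=> n [//|s]; rewrite geq_max => /andP[N0n n_gt1] _.
  apply: le_ereal_inf_tmp => _ [P solP ->]; rewrite lee_fin.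
  have hs := sites_cost_ge n_gt1 solP.
  (* As [n] is at least [N 0], index 0 is admissible, so the maximum is attained rather than being
     the default of an empty one. *)
  have Nbest : (N (best n) <= n)%N.
    rewrite /best; have [|D ND ->] // := @eq_bigmax_cond _
      (fun D : 'I_n.+1 => N D <= n)%N (fun D => val D) _.
    by apply/card_gt0P; exists ord0.
  have hn := HN _ _ _ Nbest P solP.
  move: hs hn; set C := (comm_cost _ P)%:R; set S := _.+1%:R; set W := _ `^ _ => hs hn.
  have : 0 <= W by apply: powR_ge0.
  nra.
Qed.
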